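(* Let $(M,P,g)$ be a Riemannian almost product $\mathcal{W}_3$-manifold, let $\nabla$ be the Levi-Civita connection of $g$ with curvature tensor $R$, and let $\nabla'$ be the RPT-connection on $(M,P,g)$ with torsion $$T(x,y,z)=\tfrac12\{F(x,y,Pz)+F(y,z,Px)+F(z,x,Py)\}$$ and curvature tensor $R'$. If $T$ is parallel with respect to $\nabla'$ (i.e. $\nabla'T=0$) and $R'$ is a Riemannian $P$-tensor, then $$R(x,y,z,w)=R'(x,y,z,w)-\tfrac14\,g\bigl(T(x,y),T(z,w)\bigr)$$ for all $x,y,z,w$.
   Context: A Riemannian almost product manifold $(M,P,g)$ is a differentiable manifold $M$ with a $(1,1)$-tensor field $P$ and a Riemannian metric $g$ such that $P^2x=x$, $g(Px,Py)=g(x,y)$; throughout $\mathrm{tr}\,P=0$. Put $F(x,y,z)=g((\nabla_xP)y,z)$. $(M,P,g)$ is a $\mathcal{W}_3$-manifold if $F(x,y,z)+F(y,z,x)+F(z,x,y)=0$ identically. For a linear connection $\nabla'$, $T(x,y)=\nabla'_xy-\nabla'_yx-[x,y]$ and $T(x,y,z)=g(T(x,y),z)$. An RPT-connection is a linear connection $\nabla'$ with $\nabla'P=\nabla'g=0$ whose torsion $T(x,y,z)$ is a 3-form. Thus here $\nabla'$ is given by $g(\nabla'_xy,z)=g(\nabla_xy,z)+\frac12T(x,y,z)$ with the stated $T$. Curvature: $R(x,y)z=\nabla_x\nabla_yz-\nabla_y\nabla_xz-\nabla_{[x,y]}z$, $R(x,y,z,w)=g(R(x,y)z,w)$, and $R'$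 is defined by the same formulas for $\nabla'$. A $(0,4)$-tensor $L$ is a Riemannian $P$-tensor if $L(x,y,z,w)=-L(y,x,z,w)=-L(x,y,w,z)$, $L(x,y,z,w)+L(y,z,x,w)+L(z,x,y,w)=0$ and $L(x,y,Pz,Pw)=L(x,y,z,w)$ for all $x,y,z,w$. *)

(* Defs.v *)
From HB Require Import structures.
From mathcomp Require Import all_boot all_order all_algebra.
From mathcomp Require Import all_classical all_reals all_analysis.
Set Implicit Arguments.
Unset Strict Implicit.
Unset Printing Implicit Defensive.
Import Order.TTheory GRing.Theory Num.Theory.
Import numFieldNormedType.Exports.
Local Open Scope classical_set_scope.
Local Open Scope ring_scope.

Section SmoothMaps.
Context {R : realType} {V W : normedModType R}.

Fixpoint Ck_on (U : set V) (k : nat) (f : V -> W) : Prop :=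
  (forall x, U x -> {for x, continuous f}) /\
  (if k is k'.+1 then forall v : V,
     (forall x, U x -> derivable f x v) /\ Ck_on U k' ('D_v f)
   else True).

Definition smooth_on (U : set V) (f : V -> W) : Prop :=
  forall k, Ck_on U k f.

Lemma Ck_onW U k f : Ck_on U k.+1 f -> Ck_on U k f.
Proof.
elim: k f => [|k IH] f /= [cf df]; split=> // v.
by have [dfv dvf] := df v; split=> //; apply: IH.
Qed.

Lemma Ck_on_ext U k f g : open U -> (forall x, U x -> f x = g x) ->
  Ck_on U k f -> Ck_on U k g.
Proof.
move=> oU; have near_eq (h h' : V -> W) : (forall x, U x -> h x = h' x) ->
    forall x, U x -> \forall y \near x, h y = h' y.
  move=> hh' x Ux; have : nbhs x U by exact: open_nbhs_nbhs.
  by apply: filterS.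
have cont (h h' : V -> W) : (forall x, U x -> h x = h' x) ->
    (forall x, U x -> {for x, continuous h}) ->
    forall x, U x -> {for x, continuous h'}.
  move=> hh' ch x Ux; rewrite /prop_for /continuous_at -(hh' _ Ux).
  apply: cvg_trans (ch _ Ux); apply: near_eq_cvg.
  exact: near_eq.
elim: k f g => [|k IH] f g fg /= [cf df]; split=> //; do ?exact: (cont f).
move=> v; have [dfv dvf] := df v; split=> [x Ux|].
  by apply: near_eq_derivable (dfv _ Ux); exact: near_eq.
by apply: IH dvf => x Ux; apply: near_eq_derive; exact: near_eq.
Qed.

Lemma Ck_on_cst U k (c : W) : Ck_on U k (cst c).
Proof.
elim: k c => [|k IH] c /=; split=> //; do ?by move=> x _; exact: cst_continuous.
move=> v; split=> [x _|]; first exact: derivable_cst.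
have -> : 'D_v (cst c) = cst 0 :> (V -> W); last exact: IH.
by apply/funext => x; rewrite derive_cst.
Qed.

Lemma Ck_onD U k f g : open U -> Ck_on U k f -> Ck_on U k g ->
  Ck_on U k (f + g).
Proof.
move=> oU; elim: k f g => [|k IH] f g /= [cf df] [cg dg].
  by split=> // x Ux; apply: continuousD; [exact: cf|exact: cg].
split=> [x Ux|v]; first by apply: continuousD; [exact: cf|exact: cg].
have [dfv Df] := df v; have [dgv Dg] := dg v.
split=> [x Ux|]; first by apply: derivableD; [exact: dfv|exact: dgv].
apply: (Ck_on_ext oU _ (IH _ _ Df Dg)) => x Ux.
by rewrite deriveD//; [exact: dfv|exact: dgv].
Qed.

End SmoothMaps.

Section SmoothScalar.
Context {R : realType} {V : normedModType R}.
Implicit Types (U : set V) (f g : V -> R^o).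

Lemma Ck_onM U k f g : open U -> Ck_on U k f -> Ck_on U k g ->
  Ck_on U k (f * g).
Proof.
move=> oU; elim: k f g => [|k IH] f g Kf Kg.
  case: Kf Kg => [cf _] [cg _].
  by split=> // x Ux; apply: continuousM; [exact: cf|exact: cg].
have [[cf df] [cg dg]] := (Kf, Kg).
split=> [x Ux|v]; first by apply: continuousM; [exact: cf|exact: cg].
have [dfv Df] := df v; have [dgv Dg] := dg v.
split=> [x Ux|]; first by apply: derivableM; [exact: dfv|exact: dgv].
have Kfg : Ck_on U k (f * 'D_v g + g * 'D_v f : V -> R^o).
  by apply: Ck_onD => //; apply: IH => //; exact: Ck_onW.
apply: (Ck_on_ext oU _ Kfg) => x Ux.
by rewrite deriveM//; [exact: dfv|exact: dgv].
Qed.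

End SmoothScalar.

Record chart (R : realType) (n : nat) (M : topologicalType) := Chart {
  chart_dom : set M;
  chart_map : M -> 'rV[R]_n;
  chart_inv : 'rV[R]_n -> M;
  chart_dom_open : open chart_dom;
  chart_img_open : open (chart_map @` chart_dom);
  chart_mapK : forall p, chart_dom p -> chart_inv (chart_map p) = p;
  chart_map_continuous :
    forall p, chart_dom p -> {for p, continuous chart_map};
  chart_inv_continuous :
    forall u, (chart_map @` chart_dom) u -> {for u, continuous chart_inv} }.

(* The atlas need not be maximal: it determines the smooth functions anyway. *)
Record smooth_manifold (R : realType) (n : nat) := SmoothManifold {
  manifold_space :> topologicalType;
  atlas : set (chart R n manifold_space);
  manifold_hausdorff : hausdorff_space manifold_space;
  manifold_second_countable : @second_countable manifold_space;
  atlas_cover : forall p : manifold_space, exists2 c, atlas c & chart_dom c p;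
  atlas_compatible : forall c d, atlas c -> atlas d ->
    smooth_on (chart_map c @` (chart_dom c `&` chart_dom d))
      (chart_map d \o chart_inv c) }.

Section SmoothFunctions.
Context {R : realType} {n : nat} (M : smooth_manifold R n).

Definition smooth_function (f : M -> R^o) : Prop :=
  forall c, atlas c ->
    smooth_on (chart_map c @` chart_dom c) (f \o chart_inv c).

Definition smooth_pred : {pred M -> R^o} := fun f => `[< smooth_function f >].

Lemma smooth_cst (a : R) : smooth_function (cst a).
Proof. by move=> c Ac k; exact: Ck_on_cst. Qed.

Lemma smoothD f g :
  smooth_function f -> smooth_function g -> smooth_function (f + g).
Proof.
move=> sf sg c Ac k.
exact: Ck_onD (@chart_img_open _ _ _ c) (sf c Ac k) (sg c Ac k).
Qed.

Lemma smoothM f g :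
  smooth_function f -> smooth_function g -> smooth_function (f * g).
Proof.
move=> sf sg c Ac k.
exact: Ck_onM (@chart_img_open _ _ _ c) (sf c Ac k) (sg c Ac k).
Qed.

Lemma smoothZ (a : R) f : smooth_function f -> smooth_function (a *: f).
Proof.
move=> sf; have -> : a *: f = (cst a : M -> R^o) * f by apply/funext.
by apply: smoothM => //; exact: smooth_cst.
Qed.

Lemma smooth_subring_closed : subring_closed smooth_pred.
Proof.
split=> [|f g|f g]; rewrite ?inE.
- exact: smooth_cst.
- move=> sf sg; rewrite -[- g]scaleN1r; apply: smoothD => //.
  exact: smoothZ.
- exact: smoothM.
Qed.

Lemma smooth_scaler_closed : GRing.scaler_closed smooth_pred.
Proof. by move=> a f; rewrite !inE; exact: smoothZ. Qed.

HB.instance Definition _ :=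
  GRing.isSubringClosed.Build _ smooth_pred smooth_subring_closed.
HB.instance Definition _ :=
  GRing.isScaleClosed.Build _ _ smooth_pred smooth_scaler_closed.

Record Cinf := MkCinf {
  Cinf_fun :> M -> R^o;
  Cinf_smooth : Cinf_fun \in smooth_pred }.

HB.instance Definition _ := [isSub for Cinf_fun].
HB.instance Definition _ := [Choice of Cinf by <:].
HB.instance Definition _ := GRing.SubChoice_isSubComPzRing.Build _ _ Cinf (subringClosedP _).
HB.instance Definition _ := [SubZmodule_isSubLmodule of Cinf by <:].

End SmoothFunctions.

Section VectorFields.
Context {R : realType} {n : nat} (M : smooth_manifold R n).
Local Notation C := (Cinf M).

Definition is_derivation (X : C -> C) : Prop :=
  (forall (a : R) (f g : C), X (a *: f + g) = a *: X f + X g) /\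
  (forall f g : C, X (f * g) = X f * g + f * X g).

Definition derivation_pred : {pred C -> C} := fun X => `[< is_derivation X >].

Lemma is_derivationB X Y : is_derivation X -> is_derivation Y ->
  is_derivation (X - Y).
Proof.
move=> [Xl XM] [Yl YM]; split=> [a f g|f g]; rewrite !fctE.
  by rewrite Xl Yl scalerBr opprD addrACA.
by rewrite XM YM mulrBl mulrBr opprD addrACA.
Qed.

Lemma is_derivationZ (h : C) X : is_derivation X ->
  is_derivation (fun f => h * X f).
Proof.
move=> [Xl XM]; split=> [a f g|f g].
  rewrite Xl mulrDr; congr (_ + _); apply/val_inj/funext => p.
  exact: (mulrCA (h p) a (X f p)).
by rewrite XM mulrDr mulrA (mulrCA h).
Qed.

Lemma derivation_zmod_closed : zmod_closed derivation_pred.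
Proof.
split=> [|X Y]; rewrite !inE; last exact: is_derivationB.
split=> [a f g|f g]; first by rewrite -[LHS]addr0 -[X in X + _](scaler0 _ a).
by rewrite -[LHS]addr0 -[X in X + _](mul0r g) -[X in _ + X](mulr0 f).
Qed.

HB.instance Definition _ :=
  GRing.isZmodClosed.Build _ derivation_pred derivation_zmod_closed.

(* Vector fields on M are the derivations of its algebra of smooth functions. *)
Record vfield := MkVfield {
  vfield_fun :> C -> C;
  vfield_derivation : vfield_fun \in derivation_pred }.

HB.instance Definition _ := [isSub for vfield_fun].
HB.instance Definition _ := [Choice of vfield by <:].
HB.instance Definition _ := [SubChoice_isSubZmodule of vfield by <:].

Lemma vfieldP (X : vfield) : is_derivation X.
Proof. by have := vfield_derivation X; rewrite inE. Qed.

Lemma vfield_scale_subproof (h : C) (X : vfield) :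
  (fun f => h * X f) \in derivation_pred.
Proof. by rewrite inE; apply/is_derivationZ/vfieldP. Qed.

Definition vfield_scale (h : C) (X : vfield) : vfield :=
  MkVfield (vfield_scale_subproof h X).

Lemma vfield_scaleA a b X :
  vfield_scale a (vfield_scale b X) = vfield_scale (a * b) X.
Proof. by apply/val_inj/funext => f /=; rewrite mulrA. Qed.

Lemma vfield_scale1 : left_id 1 vfield_scale.
Proof. by move=> X; apply/val_inj/funext => f /=; rewrite mul1r. Qed.

Lemma vfield_scaleDr : right_distributive vfield_scale +%R.
Proof. by move=> a X Y; apply/val_inj/funext => f /=; rewrite fctE mulrDr. Qed.

Lemma vfield_scaleDl X : {morph vfield_scale^~ X : a b / a + b}.
Proof. by move=> a b; apply/val_inj/funext => f /=; rewrite fctE mulrDl. Qed.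

HB.instance Definition _ := GRing.Zmodule_isLmodule.Build C vfield
  vfield_scaleA vfield_scale1 vfield_scaleDr vfield_scaleDl.

Lemma lie_bracket_subproof (X Y : vfield) :
  (fun f => X (Y f) - Y (X f)) \in derivation_pred.
Proof.
rewrite inE; have [[Xl XM] [Yl YM]] := (vfieldP X, vfieldP Y).
have XD f g : X (f + g) = X f + X g by have := Xl 1 f g; rewrite !scale1r.
have YD f g : Y (f + g) = Y f + Y g by have := Yl 1 f g; rewrite !scale1r.
split=> [a f g|f g]; first by rewrite Xl Yl Xl Yl scalerBr opprD addrACA.
rewrite XM YM XD YD !XM !YM mulrBl mulrBr.
have acc (a b c d e i : C) :
  a + b + (c + d) - (e + c + (b + i)) = a - e + (d - i).
  apply/eqP; rewrite subr_eq; apply/eqP; symmetry.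
  rewrite [LHS](AC ((2*2)*(2*2)) ((((1*7)*(6*3))*(5*2))*(8*4))) /=.
  by rewrite !subrr !addr0.
exact: acc.
Qed.

Definition lie_bracket (X Y : vfield) : vfield :=
  MkVfield (lie_bracket_subproof X Y).

End VectorFields.

Section AlmostProduct.
Context {R : realType} {n : nat} {M : smooth_manifold R n}.
Local Notation C := (Cinf M).
Local Notation V := (vfield M).

(* Tensor fields are represented by C^oo(M)-multilinear maps on vector fields. *)

Record riemannian_metric := RiemannianMetric {
  metric_form :> V -> V -> C;
  metric_linear : forall y, scalar (metric_form^~ y);
  metric_formC : forall x y, metric_form x y = metric_form y x;
  metric_ge0 : forall x p, 0 <= metric_form x x p;
  metric_definite : forall x p, metric_form x x p = 0 ->
    forall f : C, x f p = 0 }.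

Record linear_connection := LinearConnection {
  conn :> V -> V -> V;
  conn_linear : forall y, linear (conn^~ y);
  conn_additive : forall x, {morph conn x : y z / y + z};
  conn_leibniz : forall x (f : C) y,
    conn x (f *: y) = x f *: y + f *: conn x y }.

(* Since T_pM has dimension n, n independent tangent vectors form a basis. *)
Definition tangent_basis (p : M) (E : 'I_n -> V) : Prop :=
  forall a : 'I_n -> R,
    (forall f : C, \sum_i a i * E i f p = 0) -> forall i, a i = 0.

Definition traceless (P : V -> V) : Prop :=
  forall (p : M) (E : 'I_n -> V) (A : 'M[R]_n), tangent_basis p E ->
    (forall j (f : C), P (E j) f p = \sum_i A i j * E i f p) -> \tr A = 0.

Definition almost_product (g : riemannian_metric) (P : {linear V -> V}) : Prop :=
  [/\ forall x, P (P x) = x,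
      forall x y, g (P x) (P y) = g x y
    & traceless P].

Definition torsion (D : linear_connection) (x y : V) : V :=
  D x y - D y x - lie_bracket x y.

Definition torsion3 (g : riemannian_metric) (D : linear_connection)
  (x y z : V) : C := g (torsion D x y) z.

Definition curvature (D : linear_connection) (x y z : V) : V :=
  D x (D y z) - D y (D x z) - D (lie_bracket x y) z.

Definition curvature4 (g : riemannian_metric) (D : linear_connection)
  (x y z w : V) : C := g (curvature D x y z) w.

Definition cov_metric (D : linear_connection) (g : riemannian_metric)
  (x y z : V) : C := x (g y z) - g (D x y) z - g y (D x z).

Definition cov_endo (D : linear_connection) (P : V -> V) (x y : V) : V :=
  D x (P y) - P (D x y).

Definition cov_tensor3 (D : linear_connection) (S : V -> V -> V -> C)
  (u x y z : V) : C :=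
  u (S x y z) - S (D u x) y z - S x (D u y) z - S x y (D u z).

Definition levi_civita (g : riemannian_metric) (D : linear_connection) : Prop :=
  (forall x y, torsion D x y = 0) /\ (forall x y z, cov_metric D g x y z = 0).

Definition tensor3 (S : V -> V -> V -> C) : Prop :=
  [/\ forall y z, scalar (fun x => S x y z),
      forall x z, scalar (fun y => S x y z)
    & forall x y, scalar (fun z => S x y z)].

Definition tensor4 (L : V -> V -> V -> V -> C) : Prop :=
  [/\ forall y z w, scalar (fun x => L x y z w),
      forall x z w, scalar (fun y => L x y z w),
      forall x y w, scalar (fun z => L x y z w)
    & forall x y z, scalar (fun w => L x y z w)].

Definition three_form (S : V -> V -> V -> C) : Prop :=
  [/\ tensor3 S,
      forall x y z, S x y z = - S y x z
    & forall x y z, S x y z = - S x z y].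

(* F(x, y, z) = g((D_x P) y, z); here and in W3_manifold, D is meant to be the
   Levi-Civita connection of g. *)
Definition structure_tensor (g : riemannian_metric) (D : linear_connection)
  (P : V -> V) (x y z : V) : C := g (cov_endo D P x y) z.

Definition W3_manifold (g : riemannian_metric) (D : linear_connection)
  (P : V -> V) : Prop :=
  forall x y z, structure_tensor g D P x y z + structure_tensor g D P y z x
    + structure_tensor g D P z x y = 0.

Definition RPT_connection (g : riemannian_metric) (P : V -> V)
  (D : linear_connection) : Prop :=
  [/\ forall x y, cov_endo D P x y = 0,
      forall x y z, cov_metric D g x y z = 0
    & three_form (torsion3 g D)].

Definition riemannian_P_tensor (P : V -> V) (L : V -> V -> V -> V -> C) : Prop :=
  [/\ tensor4 L,
      forall x y z w, L x y z w = - L y x z w /\ L x y z w = - L x y w z,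
      forall x y z w, L x y z w + L y z x w + L z x y w = 0
    & forall x y z w, L x y (P z) (P w) = L x y z w].

End AlmostProduct.

Arguments riemannian_metric {R n} M.
Arguments linear_connection {R n} M.

(* Main.v *)
(* Write D' = D + K.  Since D and D' are metric and the torsion T of D' is a
   3-form, T = 2 K, so K is skew and D'-parallel, and
     R(x,y)z = R'(x,y)z - K(T(x,y),z) + K(x,K(y,z)) - K(y,K(x,z)).
   Both R and R' satisfy the first Bianchi identity, hence the cyclic sum of
   g(K(x,y),K(z,w)) over x, y, z vanishes, and this collapses the quadratic
   terms to - g(K(x,y),K(z,w)) = - g(T(x,y),T(z,w)) / 4. *)
Require Import Defs.
From mathcomp Require Import all_boot all_order all_algebra.
From mathcomp Require Import all_classical all_reals all_analysis.
From mathcomp Require Import lra.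
Import Order.TTheory GRing.Theory Num.Theory.
Set Implicit Arguments.
Unset Strict Implicit.
Unset Printing Implicit Defensive.
Local Open Scope ring_scope.

(** * Evaluation at points: identities of functions and fields become linear ones over the reals *)

Lemma Cinf_eq (R : realType) (n : nat) (M : smooth_manifold R n)
  (f h : Cinf M) : (forall p, f p = h p) -> f = h.
Proof. by move=> fh; apply/val_inj/funext. Qed.

Lemma vfield_eq (R : realType) (n : nat) (M : smooth_manifold R n)
  (x y : vfield M) : (forall f p, x f p = y f p) -> x = y.
Proof. by move=> xy; apply/val_inj/funext => f; exact: Cinf_eq (xy f). Qed.

Lemma Cinf_addE (R : realType) (n : nat) (M : smooth_manifold R n)
  (f h : Cinf M) p : (f + h) p = (f p : R) + h p.
Proof. by []. Qed.

Lemma Cinf_oppE (R : realType) (n : nat) (M : smooth_manifold R n)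
  (f : Cinf M) p : (- f) p = - (f p : R).
Proof. by []. Qed.

Lemma Cinf_zeroE (R : realType) (n : nat) (M : smooth_manifold R n) p :
  (0 : Cinf M) p = 0 :> R.
Proof. by []. Qed.

Definition Cinf_evalE := (Cinf_addE, Cinf_oppE, Cinf_zeroE).

Lemma vfield_addE (R : realType) (n : nat) (M : smooth_manifold R n)
  (x y : vfield M) f : (x + y) f = x f + y f.
Proof. by []. Qed.

Lemma vfield_oppE (R : realType) (n : nat) (M : smooth_manifold R n)
  (x : vfield M) f : (- x) f = - x f.
Proof. by []. Qed.

Lemma vfield_zeroE (R : realType) (n : nat) (M : smooth_manifold R n) f :
  (0 : vfield M) f = 0.
Proof. by []. Qed.

Definition vfield_evalE := (vfield_addE, vfield_oppE, vfield_zeroE).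

Lemma vfield_appD (R : realType) (n : nat) (M : smooth_manifold R n)
  (x : vfield M) (f h : Cinf M) : x (f + h) = x f + x h.
Proof. by have [xl _] := vfieldP x; have := xl 1 f h; rewrite !scale1r. Qed.

Lemma vfield_appB (R : realType) (n : nat) (M : smooth_manifold R n)
  (x : vfield M) (f h : Cinf M) : x (f - h) = x f - x h.
Proof. by apply/eqP; rewrite eq_sym subr_eq -vfield_appD subrK. Qed.

Lemma lie_bracketE (R : realType) (n : nat) (M : smooth_manifold R n)
  (x y : vfield M) f : lie_bracket x y f = x (y f) - y (x f).
Proof. by []. Qed.

(** Applied to [f] at [p], both sides become sums of iterated derivatives such as [x (y (z f))],
    which cancel in pairs. *)
Lemma lie_bracket_jacobi (R : realType) (n : nat) (M : smooth_manifold R n)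
  (x y z : vfield M) :
  lie_bracket (lie_bracket x y) z + lie_bracket (lie_bracket y z) x
  + lie_bracket (lie_bracket z x) y = 0.
Proof.
apply: vfield_eq => f p.
rewrite !vfield_evalE !lie_bracketE !vfield_appB !Cinf_evalE; lra.
Qed.

(** * Metric, connections and the first Bianchi identity *)

Lemma metricDl (R : realType) (n : nat) (M : smooth_manifold R n)
  (g : riemannian_metric M) x y z : g (x + y) z = g x z + g y z.
Proof. by have := metric_linear g z 1 x y; rewrite scale1r /= mul1r. Qed.

Lemma metricBl (R : realType) (n : nat) (M : smooth_manifold R n)
  (g : riemannian_metric M) x y z : g (x - y) z = g x z - g y z.
Proof. by apply/eqP; rewrite eq_sym subr_eq -metricDl subrK. Qed.

Lemma metricDr (R : realType) (n : nat) (M : smooth_manifold R n)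
  (g : riemannian_metric M) x y z : g x (y + z) = g x y + g x z.
Proof. by rewrite !(metric_formC g x) metricDl. Qed.

Lemma metricBr (R : realType) (n : nat) (M : smooth_manifold R n)
  (g : riemannian_metric M) x y z : g x (y - z) = g x y - g x z.
Proof. by rewrite !(metric_formC g x) metricBl. Qed.

(** Test against [x - y] itself and use definiteness. *)
Lemma metric_inj (R : realType) (n : nat) (M : smooth_manifold R n)
  (g : riemannian_metric M) x y : (forall z, g x z = g y z) -> x = y.
Proof.
move=> gxy; apply/subr0_eq/vfield_eq => f p.
rewrite vfield_zeroE Cinf_zeroE.
by apply: (metric_definite (r := g)); rewrite metricBl gxy subrr.
Qed.

Lemma connDl (R : realType) (n : nat) (M : smooth_manifold R n)
  (D : linear_connection M) x y z : D (x + y) z = D x z + D y z.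
Proof. by have := conn_linear D z 1 x y; rewrite !scale1r. Qed.

Lemma connBl (R : realType) (n : nat) (M : smooth_manifold R n)
  (D : linear_connection M) x y z : D (x - y) z = D x z - D y z.
Proof. by apply/eqP; rewrite eq_sym subr_eq -connDl subrK. Qed.

Lemma connBr (R : realType) (n : nat) (M : smooth_manifold R n)
  (D : linear_connection M) x y z : D x (y - z) = D x y - D x z.
Proof. by apply/eqP; rewrite eq_sym subr_eq -conn_additive subrK. Qed.

(** Second covariant derivatives cancel in the cyclic sum; what remains is the Jacobi sum up to
    sign. *)
Lemma torsion_free_bianchi (R : realType) (n : nat) (M : smooth_manifold R n)
  (D : linear_connection M) x y z : (forall x y, torsion D x y = 0) ->
  curvature D x y z + curvature D y z x + curvature D z x y = 0.
Proof.
move=> T0.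
have brE u v : lie_bracket u v = D u v - D v u by apply/esym/subr0_eq/T0.
(* Vanishing torsion for the pair [[u,v]], [w] trades a derivative along the bracket for a
   derivative of the bracket. *)
have brD u v w : D (lie_bracket u v) w =
    D w (D u v) - D w (D v u) + lie_bracket (lie_bracket u v) w.
  by rewrite -connBr -brE [X in _ + X]brE addrC subrK.
have J := lie_bracket_jacobi x y z.
apply: vfield_eq => f p; move/(congr1 (fun v : vfield M => v f p)): J.
by rewrite /curvature !brD !vfield_evalE !Cinf_evalE; lra.
Qed.

(** * The difference tensor [K = D' - D] *)

(* Locked because [rewrite metricBl] would otherwise split it. *)
Definition conn_diff {R : realType} {n : nat} {M : smooth_manifold R n}
  (D D' : linear_connection M) (x y : vfield M) : vfield M :=
  locked (D' x y - D x y).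

Lemma conn_diffE (R : realType) (n : nat) (M : smooth_manifold R n)
  (D D' : linear_connection M) x y : D x y = D' x y - conn_diff D D' x y.
Proof. by rewrite /conn_diff -!lock opprB addrC subrK. Qed.

Lemma conn_diffBl (R : realType) (n : nat) (M : smooth_manifold R n)
  (D D' : linear_connection M) x y z :
  conn_diff D D' (x - y) z = conn_diff D D' x z - conn_diff D D' y z.
Proof.
apply: vfield_eq => f p; rewrite /conn_diff -!lock !connBl.
by rewrite !vfield_evalE !Cinf_evalE; lra.
Qed.

Lemma conn_diffDl (R : realType) (n : nat) (M : smooth_manifold R n)
  (D D' : linear_connection M) x y z :
  conn_diff D D' (x + y) z = conn_diff D D' x z + conn_diff D D' y z.
Proof.
apply: vfield_eq => f p; rewrite /conn_diff -!lock !connDl.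
by rewrite !vfield_evalE !Cinf_evalE; lra.
Qed.

Lemma conn_diffBr (R : realType) (n : nat) (M : smooth_manifold R n)
  (D D' : linear_connection M) x y z :
  conn_diff D D' x (y - z) = conn_diff D D' x y - conn_diff D D' x z.
Proof.
apply: vfield_eq => f p; rewrite /conn_diff -!lock !connBr.
by rewrite !vfield_evalE !Cinf_evalE; lra.
Qed.

Lemma conn_diff_torsion (R : realType) (n : nat) (M : smooth_manifold R n)
  (D D' : linear_connection M) x y : (forall x y, torsion D x y = 0) ->
  torsion D' x y = conn_diff D D' x y - conn_diff D D' y x.
Proof.
move=> /(_ x y) T0; apply: vfield_eq => f p.
move/(congr1 (fun v : vfield M => v f p)): T0.
by rewrite /torsion /conn_diff -!lock !vfield_evalE !Cinf_evalE; lra.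
Qed.

(** The term [x (g y z)] cancels between the two compatibility equations. *)
Lemma conn_diff_metric (R : realType) (n : nat) (M : smooth_manifold R n)
  (g : riemannian_metric M) (D D' : linear_connection M) x y z :
  (forall x y z, cov_metric D g x y z = 0) ->
  (forall x y z, cov_metric D' g x y z = 0) ->
  g (conn_diff D D' x y) z = - g y (conn_diff D D' x z).
Proof.
move=> /(_ x y z) gD /(_ x y z) gD'; apply: Cinf_eq => p.
move/(congr1 (fun f : Cinf M => f p)): gD.
move/(congr1 (fun f : Cinf M => f p)): gD'.
rewrite /cov_metric /conn_diff -!lock metricBl metricBr !Cinf_evalE; lra.
Qed.

(** A Koszul-type argument: put k(x,y,z) = g(K(x,y),z), skew in y, z. In T(x,y,z) - T(y,z,x) +
    T(z,x,y) all terms cancel except 2k(x,y,z), while cyclic invariance of T makes this sum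
    T(x,y,z). *)
Lemma torsion_conn_diff (R : realType) (n : nat) (M : smooth_manifold R n)
  (g : riemannian_metric M) (D D' : linear_connection M) x y :
  levi_civita g D -> (forall x y z, cov_metric D' g x y z = 0) ->
  three_form (torsion3 g D') ->
  torsion D' x y = conn_diff D D' x y + conn_diff D D' x y.
Proof.
move=> [T0 gD] gD' [_ T12 T23].
apply: (metric_inj (g := g)) => z; apply: Cinf_eq => p.
have Tyzx : torsion3 g D' x y z = torsion3 g D' y z x.
  by rewrite T12 T23 opprK.
have Tzxy : torsion3 g D' x y z = torsion3 g D' z x y.
  by rewrite T23 T12 opprK.
have sk u v w := congr1 (fun f : Cinf M => f p)
  (conn_diff_metric u v w gD gD').
have := (sk x y z, sk y z x, sk z x y).
move/(congr1 (fun f : Cinf M => f p)): Tyzx.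
move/(congr1 (fun f : Cinf M => f p)): Tzxy.
rewrite /torsion3 !(conn_diff_torsion D' _ _ T0) !metricBl !metricDl.
(* Symmetry of [g] moves [x], [y], [z] to the second slot, so that equal terms are recognised as
   equal. *)
rewrite !(metric_formC g x) !(metric_formC g y) !(metric_formC g z).
rewrite !Cinf_evalE => ? ? [[? ?] ?]; lra.
Qed.

(** Since T = 2K, parallelism of g(T(x,y),z) gives that of K: as [D'] is metric, the terms in
    [D' u z] drop out. *)
Lemma conn_diff_parallel (R : realType) (n : nat) (M : smooth_manifold R n)
  (g : riemannian_metric M) (D D' : linear_connection M) u x y :
  levi_civita g D -> (forall x y z, cov_metric D' g x y z = 0) ->
  three_form (torsion3 g D') ->
  (forall u x y z, cov_tensor3 D' (torsion3 g D') u x y z = 0) ->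
  D' u (conn_diff D D' x y) =
    conn_diff D D' (D' u x) y + conn_diff D D' x (D' u y).
Proof.
move=> LC gD' T3 pT; apply: (metric_inj (g := g)) => z; apply: Cinf_eq => p.
have TK v w := torsion_conn_diff v w LC gD' T3.
move/(congr1 (fun f : Cinf M => f p)): (pT u x y z).
move/(congr1 (fun f : Cinf M => f p)): (gD' u (conn_diff D D' x y) z).
rewrite /cov_tensor3 /cov_metric /torsion3 !TK !metricDl vfield_appD.
by rewrite !Cinf_evalE; lra.
Qed.

(** Substitute D = D' - K and expand derivatives of K by parallelism. Terms such as K(y,D'_x z) +
    K(x,D'_y z) are symmetric in x, y and cancel; those with K differentiated in its first slot join
    K([x,y],z) to form K(T(x,y),z). *)
Lemma curvature_conn_diff (R : realType) (n : nat) (M : smooth_manifold R n)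
  (D D' : linear_connection M) (K := conn_diff D D') x y z :
  (forall u x y, D' u (K x y) = K (D' u x) y + K x (D' u y)) ->
  curvature D x y z =
    curvature D' x y z - K (torsion D' x y) z + K x (K y z) - K y (K x z).
Proof.
move=> pK.
have DE u v : D u v = D' u v - K u v by exact: conn_diffE.
rewrite /curvature !DE !connBr !pK /K /torsion !(conn_diffBl, conn_diffBr).
by apply: vfield_eq => f p; rewrite !vfield_evalE !Cinf_evalE; lra.
Qed.

Theorem theorem4p1 (R : realType) (n : nat) (M : smooth_manifold R n)
    (g : riemannian_metric M) (P : {linear vfield M -> vfield M})
    (D D' : linear_connection M) :
  almost_product g P ->
  levi_civita g D ->
  W3_manifold g D P ->
  RPT_connection g P D' ->
  (forall x y z : vfield M,
     torsion3 g D' x y z =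
       (2^-1 : R) *: (structure_tensor g D P x y (P z)
                      + structure_tensor g D P y z (P x)
                      + structure_tensor g D P z x (P y))) ->
  (forall u x y z : vfield M, cov_tensor3 D' (torsion3 g D') u x y z = 0) ->
  riemannian_P_tensor P (curvature4 g D') ->
  forall x y z w : vfield M,
    curvature4 g D x y z w =
      curvature4 g D' x y z w
      - (4^-1 : R) *: g (torsion D' x y) (torsion D' z w).
Proof.
move=> _ LC _ [_ gD' T3] _ pT [_ _ bianchi' _] x y z w.
have [T0 _] := LC; have [_ T12 _] := T3.
pose K := conn_diff D D'.
have TK u v : torsion D' u v = K u v + K u v.
  exact: (torsion_conn_diff _ _ LC gD' T3).
have pK u v t : D' u (K v t) = K (D' u v) t + K v (D' u t).
  exact: (conn_diff_parallel _ _ _ LC gD' T3 pT).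
have KD u v t : K (u + v) t = K u t + K v t by exact: conn_diffDl.
have sk u v t : g (K u v) t = - g v (K u t).
  by case: LC => _ gD; exact: conn_diff_metric.
have RK a b c : curvature D a b c =
    curvature D' a b c - K (torsion D' a b) c + K a (K b c) - K b (K a c).
  exact: curvature_conn_diff pK.
clearbody K.
(* T is skew in its first two arguments and equals 2K. *)
have KC u v t : g (K u v) t = - g (K v u) t.
  apply: Cinf_eq => p; have := congr1 (fun f : Cinf M => f p) (T12 u v t).
  by rewrite /torsion3 !TK !metricDl !Cinf_evalE; lra.
have skr u v a b : g (K u (K a b)) v = - g (K a b) (K u v) by rewrite sk.
have skl u v a b : g (K (K a b) u) v = g (K a b) (K u v).
  by rewrite KC skr opprK.
(* Skewness turns every quadratic term into a product g(K,K) with [w] inside the second factor; the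
   repeated term comes from T = 2K. *)
have RE a b c p : curvature4 g D a b c w p = curvature4 g D' a b c w p
    - (g (K a b) (K c w) p + g (K a b) (K c w) p)
    - g (K b c) (K a w) p + g (K a c) (K b w) p :> R.
  rewrite /curvature4 RK TK KD; move: (curvature D' a b c) => r.
  by rewrite metricBl metricDl metricBl metricDl skl !skr !Cinf_evalE; lra.
apply: Cinf_eq => p.
have B : curvature4 g D x y z w p + curvature4 g D y z x w p
    + curvature4 g D z x y w p = 0 :> R.
  rewrite -!Cinf_addE -!metricDl torsion_free_bianchi//.
  (* Writing the zero field as [x - x] makes [g 0 w] vanish. *)
  by rewrite -(subrr x) metricBl subrr.
have B' := congr1 (fun f : Cinf M => f p) (bianchi' x y z w).
rewrite !Cinf_evalE in B'; rewrite !RE in B *.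
rewrite [RHS](_ : _ = curvature4 g D' x y z w p
    - 4^-1 * g (torsion D' x y) (torsion D' z w) p :> R)// !TK.
rewrite !metricDl !metricDr !Cinf_evalE.
(* Orient all pairs cyclically. With a = g(K(x,y),K(z,w)) and S the cyclic sum of a over x, y, z,
   [RE] reads R = R' - a - S. Its cyclic sum with both Bianchi identities gives 4S = 0, and
   g(T(x,y),T(z,w)) = 4a. *)
have KCp u v t : g (K u v) t p = - g (K v u) t p :> R by rewrite KC.
rewrite !(KCp y x) !(KCp z y) !(KCp x z) in B *.
lra.
Qed.
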